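(* Let $d,k\ge 1$ and let $a_1,\dots,a_k\in M_d(\mathbb{C})$ satisfy $\sum_{i=1}^k a_i^*a_i=\mathbf 1$. Let $\theta_0$ be a $d\times d$ density matrix and let $(\Theta_n)_{n\in\mathbb{N}}$ be the quantum trajectory on $(\Omega,\Sigma,\mathbb{P}_{\theta_0})$ with initial state $\theta_0$ associated with the repeated perfect measurement given by $a_1,\dots,a_k$. Then at least one of the following holds: the quantum trajectory purifies with probability 1, i.e. for $\mathbb{P}_{\theta_0}$-almost every $\omega$ one has $\lim_{n\to\infty}\operatorname{tr}\bigl(\Theta_n(\omega)^m\bigr)=1$ for all integers $m\ge1$; or there exists an orthogonal projection $p\in M_d(\mathbb{C})$ of rank at least 2 such that for all integers $l\ge1$ and all $i_1,\dots,i_l\in\{1,\dots,k\}$ there is $\lambda_{i_1,\dots,i_l}\ge0$ with $$p\,a_{i_1}^*\cdots a_{i_l}^*\,a_{i_l}\cdots a_{i_1}\,p=\lambda_{i_1,\dots,i_l}\,p .$$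
   Context: $M_d(\mathbb{C})$ is the algebra of complex $d\times d$ matrices, $\mathbf 1$ its identity. A density matrix is a positive semidefinite matrix of trace 1. Perfect measurement: given $a_1,\dots,a_k\in M_d(\mathbb{C})$ with $\sum_i a_i^*a_i=\mathbf 1$, put $T_i(\theta)=a_i\theta a_i^*$. Let $\Omega=\{1,\dots,k\}^{\{1,2,3,\dots\}}$ be the space of infinite outcome sequences $\omega=(\omega_1,\omega_2,\dots)$, let $\Sigma$ be the $\sigma$-algebra generated by the cylinder sets $\Lambda_{i_1,\dots,i_m}=\{\omega:\omega_1=i_1,\dots,\omega_m=i_m\}$, and let $\mathbb{P}_{\theta_0}$ be the unique probability measure on $(\Omega,\Sigma)$ with $$\mathbb{P}_{\theta_0}(\Lambda_{i_1,\dots,i_m})=\operatorname{tr}\bigl(T_{i_m}\circ\cdots\circ T_{i_1}(\theta_0)\bigr).$$ The quantum trajectory is the sequence of random density matrices $$\Theta_n(\omega)=\frac{T_{\omega_n}\circ\cdots\circ T_{\omega_1}(\theta_0)}{\operatorname{tr}\bigl(T_{\omega_n}\circ\cdots\circ T_{\omega_1}(\theta_0)\bigr)},\qquad \Theta_0=\theta_0,$$ defined $\mathbb{P}_{\theta_0}$-almost surely (where the denominators are nonzero). It is a Markov chain with transitions $\theta\to a_i\theta a_i^*/\operatorname{tr}(a_i\theta a_i^* )$ with probability $\operatorname{tr}(a_i\theta a_i^* )$. *)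

(* Defs.v *)
(* The complex numbers are R[i], for R : realType. *)
From HB Require Import structures.
From mathcomp Require Export all_boot all_order all_algebra complex.
From mathcomp Require Export all_classical all_reals all_analysis.

Set Implicit Arguments.
Unset Strict Implicit.
Unset Printing Implicit Defensive.

Import Order.TTheory GRing.Theory Num.Theory.
Import numFieldNormedType.Exports.

Local Open Scope classical_set_scope.
Local Open Scope complex_scope.
Local Open Scope sesquilinear_scope.
Local Open Scope ring_scope.

(* Generated sigma-algebras require a pointed carrier; this is why the outcomes
   are indexed by 'I_k.+1, i.e. there are k.+1 >= 1 of them. *)
HB.instance Definition _ (k : nat) := isPointed.Build 'I_k.+1 ord0.

(* Sequences are indexed from 0: the outcome omega_(n+1) is [w n]. *)
Definition cylinder (k : nat) (s : seq 'I_k.+1) : set (nat -> 'I_k.+1) :=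
  [set w | mkseq w (size s) = s].

Notation outcome_space k := (g_sigma_algebraType (range (@cylinder k))).

Section QuantumTrajectories.
Variables (R : realType) (d : nat).

(* In R[i], [0 <= z] means that z is real and nonnegative. *)
Definition psdmx (A : 'M[R[i]]_d) : Prop :=
  A \is hermsymmx /\ forall v : 'cV[R[i]]_d, 0 <= (v ^t* *m A *m v) 0 0.

Definition density_matrix (A : 'M[R[i]]_d) : Prop := psdmx A /\ \tr A = 1.

Definition orthogonal_projection (p : 'M[R[i]]_d) : Prop :=
  p \is hermsymmx /\ p *m p = p.

Variables (k : nat) (a : 'I_k.+1 -> 'M[R[i]]_d).

Definition perfect_measurement : Prop := \sum_i (a i) ^t* *m a i = 1%:M.

Definition measurement_map (i : 'I_k.+1) (theta : 'M[R[i]]_d) : 'M[R[i]]_d :=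
  a i *m theta *m (a i) ^t*.

(* For s = [:: i_1; ...; i_m], this is (T_(i_m) \o ... \o T_(i_1)) theta. *)
Definition measurement_word (s : seq 'I_k.+1) (theta : 'M[R[i]]_d) :
    'M[R[i]]_d :=
  foldl (fun th i => measurement_map i th) theta s.

Variable theta0 : 'M[R[i]]_d.

(* By uniqueness this characterizes the law of the outcomes. The trace is real
   (and nonnegative) as soon as theta0 is positive semidefinite, so that taking
   its real part only changes its type. *)
Definition outcome_law (P : probability (outcome_space k) R) : Prop :=
  forall s : seq 'I_k.+1,
    P (cylinder s) = (complex.Re (\tr (measurement_word s theta0)))%:E.

(* Where the trace vanishes, a null set for the law of the outcomes, the
   quotient takes the junk value 0. *)
Definition quantum_trajectory (n : nat) (w : outcome_space k) : 'M[R[i]]_d :=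
  let theta := measurement_word (mkseq w n) theta0 in
  (\tr theta)^-1 *: theta.

(* R[i]^o carries the topology of the modulus. *)
Definition purifies_ae (P : probability (outcome_space k) R) : Prop :=
  {ae P, forall w, forall m : nat, (0 < m)%N ->
    (\tr (quantum_trajectory n w ^+ m) : R[i]^o) @[n --> \oo]
      --> (1 : R[i]^o)}.

(* For s = [:: i_1; ...; i_l] the two products are a_(i_1)^* ... a_(i_l)^* and
   a_(i_l) ... a_(i_1). *)
Definition dark_projection (p : 'M[R[i]]_d) : Prop :=
  forall s : seq 'I_k.+1, (0 < size s)%N ->
    exists2 lambda : R, 0 <= lambda &
      p *m (\prod_(i <- s) (a i) ^t*) *m (\prod_(i <- rev s) a i) *m p
      = lambda%:C *: p.

End QuantumTrajectories.

(* Main.v *)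
(* Words act on pairs of vectors, written as the two rows of a 2 x d matrix Y,
   and the area of the pair, sqrt (det H) with H = Y Y^*, is multiplied by
   |det M| when Y is replaced by M Y. For orthonormal rows, AM-GM bounds the
   sum over all words of length n of the areas of the images by 1, with
   equality for every n only if all the images have a scalar Gram matrix,
   i.e. if the projection onto the span of the rows is dark. Without dark
   projections, compactness of the set of orthonormal pairs and
   multiplicativity make that sum decay geometrically, uniformly in Y. Now,
   for theta0 = B^* B, the difference (tr theta)^2 - tr (theta^2) of the
   unnormalized state theta after a word is the sum of the squared areas of
   the images of all pairs of rows of B. As the probability of a word is tr
   theta, the expectation of sqrt (1 - tr (Theta_n^2)) decays geometrically,
   and Borel-Cantelli concludes. *)
Require Import Defs.
From mathcomp Require Import ring lra.
Set Implicit Arguments.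
Unset Strict Implicit.
Unset Printing Implicit Defensive.
Import Order.TTheory GRing.Theory Num.Theory.
Import numFieldNormedType.Exports.
Local Open Scope classical_set_scope.
Local Open Scope complex_scope.
Local Open Scope sesquilinear_scope.
Local Open Scope ring_scope.

(** * Indices and determinants of size 2 *)

Lemma ord2P (i : 'I_2) : i = 0 \/ i = 1.
Proof. by case: i => [[|[|//]]] lt_i2; [left|right]; exact/val_inj. Qed.

Lemma lift00_ord2 : lift 0 0 = 1 :> 'I_2.
Proof. exact/val_inj. Qed.

Lemma det_mx22 (K : comPzRingType) (A : 'M[K]_2) :
  \det A = A 0 0 * A 1 1 - A 0 1 * A 1 0.
Proof.
rewrite (expand_det_row _ 0) !big_ord_recl big_ord0 /cofactor !det_mx11 !mxE.
rewrite !lift00_ord2.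
have -> : lift 1 0 = 0 :> 'I_2 by exact/val_inj.
by rewrite addr0 add0n expr0 expr1 mul1r mulN1r mulrN.
Qed.

(** * Area and trace of the Gram matrix of a pair of rows *)

Section Area.
Variable R : realType.
Local Notation C := R[i].

Lemma trmxC_mul m n p (A : 'M[C]_(m, n)) (B : 'M[C]_(n, p)) :
  (A *m B) ^t* = B ^t* *m A ^t*.
Proof. by rewrite trmx_mul map_mxM. Qed.

(** The determinant is real and nonnegative, see [det_gramE]; the real part only changes its
    type. *)
Definition area n (Y : 'M[C]_(2, n)) : R :=
  Num.sqrt (complex.Re (\det (Y *m Y ^t*))).

Lemma area_ge0 n (Y : 'M[C]_(2, n)) : 0 <= area Y.
Proof. exact: sqrtr_ge0. Qed.

Lemma area_mull n (M : 'M[C]_2) (Y : 'M[C]_(2, n)) :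
  area (M *m Y) = Normc.normc (\det M) * area Y.
Proof.
rewrite /area trmxC_mul -mulmxA (mulmxA Y) !det_mulmx.
have -> : \det (M ^t*) = (\det M)^*%C by rewrite det_map_mx det_tr.
set D := \det (_ *m _ ^t*); case: (\det M) => x y; case: D => u v /=.
rewrite -sqrtrM ?addr_ge0 ?sqr_ge0//; congr (Num.sqrt _); ring.
Qed.

(** Gram-Schmidt. [schmidt] returns orthonormal rows even when those of [Y] are dependent, which
    takes [2 <= n]; [M] is then singular. *)
Lemma orthonormal_factor n (Y : 'M[C]_(2, n)) : (2 <= n)%N ->
  exists M (U : 'M[C]_(2, n)), U *m U ^t* = 1%:M /\ Y = M *m U.
Proof.
move=> n2; have /submxP[M YE] := schmidt_sub Y.
by exists M, (schmidt Y); split => //; apply/unitarymxP/schmidt_unitarymx.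
Qed.

Lemma det_gram_lt2 n (Y : 'M[C]_(2, n)) : (n < 2)%N -> \det (Y *m Y ^t*) = 0.
Proof.
move=> n2; apply/eqP; apply: contraTT n2; rewrite -unitfE -leqNgt.
rewrite -[_ \is a _]/(_ \in unitmx) => /mxrank_unit rk2.
by rewrite -{1}rk2 (leq_trans (mxrankM_maxl _ _))// rank_leq_col.
Qed.

Lemma area_lt2 n (Y : 'M[C]_(2, n)) : (n < 2)%N -> area Y = 0.
Proof. by move=> n2; rewrite /area det_gram_lt2//= sqrtr0. Qed.

(** Along [Y = M U] with [U] orthonormal, the determinant becomes [|det M|^2]. *)
Lemma det_gram_ge0 n (Y : 'M[C]_(2, n)) : 0 <= \det (Y *m Y ^t*).
Proof.
have [/det_gram_lt2->//|n2] := ltnP n 2.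
have [M [U [U1 ->]]] := orthonormal_factor Y n2.
rewrite trmxC_mul mulmxA -(mulmxA M) U1 mulmx1 det_mulmx det_map_mx det_tr.
exact: mul_conjC_ge0.
Qed.

Lemma det_gramE n (Y : 'M[C]_(2, n)) : \det (Y *m Y ^t*) = (area Y ^+ 2)%:C.
Proof.
have := det_gram_ge0 Y; rewrite /area; case: (\det _) => u v.
by rewrite lecE /= => /andP[/eqP-> u0]; rewrite sqr_sqrtr.
Qed.

(** The squared Frobenius norm. At [B *m word_op a s] it is the probability of the word [s], see
    [cylinder_law]. *)
Definition gram_trace m n (Y : 'M[C]_(m, n)) : R :=
  complex.Re (\tr (Y *m Y ^t*)).

Lemma gram_conjE m n (Y : 'M[C]_(m, n)) i j :
  (Y *m Y ^t*) j i = ((Y *m Y ^t*) i j)^*%C.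
Proof.
have {1}-> : Y *m Y ^t* = (Y *m Y ^t*) ^t* by rewrite trmxC_mul trmxCK.
by rewrite !mxE.
Qed.

Lemma gram_diag_ge0 m n (Y : 'M[C]_(m, n)) i : 0 <= (Y *m Y ^t*) i i.
Proof. by rewrite mxE sumr_ge0// => j _; rewrite !mxE mul_conjC_ge0. Qed.

Lemma gram_traceE m n (Y : 'M[C]_(m, n)) : \tr (Y *m Y ^t*) = (gram_trace Y)%:C.
Proof.
have : 0 <= \tr (Y *m Y ^t*) by apply: sumr_ge0 => i _; exact: gram_diag_ge0.
by rewrite /gram_trace; case: (\tr _) => u v; rewrite lecE /= => /andP[/eqP->].
Qed.

Lemma gram_trace_ge0 m n (Y : 'M[C]_(m, n)) : 0 <= gram_trace Y.
Proof.
rewrite -lecR -gram_traceE; apply: sumr_ge0 => i _; exact: gram_diag_ge0.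
Qed.

Lemma gram_trace2 n (Y : 'M[C]_(2, n)) :
  gram_trace Y = complex.Re ((Y *m Y ^t*) 0 0 + (Y *m Y ^t*) 1 1).
Proof.
by rewrite /gram_trace /mxtrace !big_ord_recl big_ord0 addr0 lift00_ord2.
Qed.

(* With [[x, z], [z^*, y]] the Gram matrix of the two rows, this is
   4 (x y - |z|^2) = (x + y)^2 - (x - y)^2 - 4 |z|^2. *)
Lemma area_gram n (Y : 'M[C]_(2, n)) : let H := Y *m Y ^t* in
  4 * area Y ^+ 2 = gram_trace Y ^+ 2 -
    (complex.Re (H 0 0 - H 1 1) ^+ 2 +
     4 * (complex.Re (H 0 1) ^+ 2 + complex.Im (H 0 1) ^+ 2)).
Proof.
move=> H; apply: complexI; rewrite rmorphM/= -det_gramE -/H.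
rewrite gram_trace2 -/H det_mx22.
have H10 : H 1 0 = (H 0 1)^*%C by exact: gram_conjE.
have := gram_diag_ge0 Y 0; have := gram_diag_ge0 Y 1; rewrite -/H H10.
case: (H 0 0) => x x'; case: (H 1 1) => y y'; case: (H 0 1) => u v.
rewrite !lecE/= => /andP[/eqP-> _] /andP[/eqP-> _].
by simpc; congr (_ +i* _) => /=; ring.
Qed.

(** AM-GM for the eigenvalues of the Gram matrix: in [area_gram] the subtracted term is a sum of
    squares. *)
Lemma area_le_trace n (Y : 'M[C]_(2, n)) : area Y <= gram_trace Y / 2.
Proof.
have := area_gram Y => /= E; have t0 := gram_trace_ge0 Y.
rewrite -(@ler_pXn2r _ 2) ?nnegrE ?area_ge0 ?divr_ge0//.
have := sqr_ge0 (complex.Re ((Y *m Y ^t*) 0 0 - (Y *m Y ^t*) 1 1)).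
have := sqr_ge0 (complex.Re ((Y *m Y ^t*) 0 1)).
have := sqr_ge0 (complex.Im ((Y *m Y ^t*) 0 1)).
lra.
Qed.

(** Equality makes every subtracted square in [area_gram] vanish, so the diagonal entries agree and
    the others are 0. *)
Lemma area_eq_trace n (Y : 'M[C]_(2, n)) : area Y = gram_trace Y / 2 ->
  Y *m Y ^t* = (area Y)%:C%:M.
Proof.
move=> e; have := area_gram Y => /=; rewrite {1}e.
set H := Y *m Y ^t* => E.
have s1 := sqr_ge0 (complex.Re (H 0 0 - H 1 1)).
have s2 := sqr_ge0 (complex.Re (H 0 1)).
have s3 := sqr_ge0 (complex.Im (H 0 1)).
have z1 : complex.Re (H 0 0 - H 1 1) = 0.
  by apply/eqP; rewrite -sqrf_eq0; apply/eqP; lra.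
have z2 : complex.Re (H 0 1) = 0.
  by apply/eqP; rewrite -sqrf_eq0; apply/eqP; lra.
have z3 : complex.Im (H 0 1) = 0.
  by apply/eqP; rewrite -sqrf_eq0; apply/eqP; lra.
have H10 : H 1 0 = (H 0 1)^*%C by exact: gram_conjE.
have := gram_diag_ge0 Y 0; have := gram_diag_ge0 Y 1; rewrite -/H => h1 h0.
have H01 : H 0 1 = 0 by move: z2 z3; case: (H 0 1) => u v /= -> ->.
have H00 : H 0 0 = (area Y)%:C.
  rewrite e gram_trace2 -/H; move: z1 h0 h1.
  case: (H 0 0) => x x'; case: (H 1 1) => y y' /=.
  rewrite !lecE/= => z1 /andP[/eqP-> _] _.
  by congr (_ +i* _); lra.
have H11 : H 1 1 = (area Y)%:C.
  rewrite e gram_trace2 -/H; move: z1 h0 h1.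
  case: (H 0 0) => x x'; case: (H 1 1) => y y' /=.
  rewrite !lecE/= => z1 _ /andP[/eqP-> _].
  by congr (_ +i* _); lra.
apply/matrixP => i j; rewrite [RHS]mxE -/H.
by case: (ord2P i) (ord2P j) => -> [] ->;
  rewrite ?H00 ?H11 ?H01 ?H10 ?H01 ?conjc0.
Qed.

End Area.

(** * Words of a given length over a finite alphabet *)

Section Words.
Variable I : finType.

Fixpoint words n : seq (seq I) :=
  if n is m.+1 then [seq i :: s | i <- enum I, s <- words m] else [:: [::]].

Lemma mem_words n (s : seq I) : (s \in words n) = (size s == n).
Proof.
elim: n s => [|n IHn] [|i s] //=.
  by apply/negP => /allpairsP[[? ?] [_ _]].
rewrite eqSS -IHn; apply/allpairsP/idP => [[[j t] /= [_ tn [_ ->]]]//|sn].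
by exists (i, s); rewrite mem_enum.
Qed.

Lemma sum_wordsS (V : nmodType) n (F : seq I -> V) :
  \sum_(s <- words n.+1) F s = \sum_i \sum_(s <- words n) F (i :: s).
Proof. by rewrite big_allpairs_dep big_enum. Qed.

Lemma sum_words_add (V : nmodType) m n (F : seq I -> V) :
  \sum_(s <- words (m + n)) F s =
  \sum_(s <- words m) \sum_(t <- words n) F (s ++ t).
Proof.
elim: m F => [|m IHm] F; first by rewrite big_seq1.
by rewrite addSn !sum_wordsS; apply: eq_bigr => i _; rewrite IHm.
Qed.

End Words.

(** * Mean areas along words and their strict contraction *)

Section Contraction.
Variables (R : realType) (d k : nat) (a : 'I_k.+1 -> 'M[R[i]]_d).
Hypothesis a_perfect : perfect_measurement a.
Local Notation C := R[i].

(** The adjoint of [a_(i_l) ... a_(i_1)]: vectors are stored as rows, on which operators act from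
    the right. *)
Definition word_op (s : seq 'I_k.+1) : 'M[C]_d := \prod_(i <- s) (a i) ^t*.

Lemma word_op_cons i s : word_op (i :: s) = (a i) ^t* *m word_op s.
Proof. by rewrite /word_op big_cons. Qed.

Lemma word_op_cat s t : word_op (s ++ t) = word_op s *m word_op t.
Proof. by rewrite /word_op big_cat. Qed.

Lemma word_opC s : (word_op s) ^t* = \prod_(i <- rev s) a i.
Proof.
elim: s => [|i s IHs]; first by rewrite /word_op !big_nil trmx1 map_mx1.
by rewrite word_op_cons trmxC_mul trmxCK IHs rev_cons big_rcons.
Qed.

(** By induction the sum over the tails collapses first, which leaves [a_i^* a_i] for each first
    letter. *)
Lemma sum_word_op n : \sum_(s <- words _ n) word_op s *m (word_op s) ^t* = 1%:M.
Proof.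
elim: n => [|n IHn].
  by rewrite big_seq1 /word_op big_nil mul1mx trmx1 map_mx1.
rewrite sum_wordsS -[RHS]a_perfect; apply: eq_bigr => i _.
under eq_bigr => s _ do
  rewrite word_op_cons trmxC_mul trmxCK mulmxA -(mulmxA _ (word_op s)).
by rewrite -mulmx_suml -mulmx_sumr IHn mulmx1.
Qed.

Lemma sum_gram_trace m n (Y : 'M[C]_(m, d)) :
  \sum_(s <- words _ n) gram_trace (Y *m word_op s) = gram_trace Y.
Proof.
apply: complexI; rewrite rmorph_sum/= -gram_traceE.
under eq_bigr => s _ do rewrite -gram_traceE trmxC_mul mulmxA -(mulmxA Y).
by rewrite -raddf_sum -mulmx_suml -mulmx_sumr sum_word_op mulmx1.
Qed.

(** No probability weights appear: the images are not normalized, and their areas already carry the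
    weights. *)
Definition mean_area n (Y : 'M[C]_(2, d)) : R :=
  \sum_(s <- words _ n) area (Y *m word_op s).

Lemma mean_area_mull n M Y :
  mean_area n (M *m Y) = Normc.normc (\det M) * mean_area n Y.
Proof.
by rewrite mulr_sumr; apply: eq_bigr => s _; rewrite -area_mull mulmxA.
Qed.

Lemma mean_areaD m n Y :
  mean_area (m + n) Y = \sum_(s <- words _ m) mean_area n (Y *m word_op s).
Proof.
rewrite /mean_area sum_words_add; apply: eq_bigr => s _.
by apply: eq_bigr => t _; rewrite word_op_cat mulmxA.
Qed.

Lemma gram_trace_orthonormal (U : 'M[C]_(2, d)) :
  U *m U ^t* = 1%:M -> gram_trace U = 2.
Proof.
by move=> U1; apply: complexI; rewrite -gram_traceE U1 mxtrace1 rmorph_nat.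
Qed.

Lemma mean_area_orthonormal_le1 n (U : 'M[C]_(2, d)) :
  U *m U ^t* = 1%:M -> mean_area n U <= 1.
Proof.
move=> U1.
apply: (@le_trans _ _ (\sum_(s <- words _ n) gram_trace (U *m word_op s) / 2)).
  by apply: ler_sum => s _; exact: area_le_trace.
by rewrite -mulr_suml sum_gram_trace gram_trace_orthonormal// divff.
Qed.

(** Along [Y = M U] both sides scale by [|det M|], so that orthonormal pairs suffice. *)
Lemma mean_area_bound n q :
  (forall U, U *m U ^t* = 1%:M -> mean_area n U <= q) ->
  forall Y, mean_area n Y <= q * area Y.
Proof.
(* For [d < 2] there is no orthonormal pair to factor through, but all areas vanish. *)
move=> Uq Y; have [d2|d2] := ltnP d 2.
  rewrite /mean_area big1 ?(area_lt2 Y d2) ?mulr0// => s _.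
  by rewrite area_lt2.
have [M [U [U1 ->]]] := orthonormal_factor Y d2.
have U_area : area U = 1 by rewrite /area U1 det1 sqrtr1.
rewrite mean_area_mull area_mull U_area mulr1 mulrC ler_wpM2r ?Uq//.
by case: (\det M) => x y; exact: sqrtr_ge0.
Qed.

Lemma mean_area_le_area n Y : mean_area n Y <= area Y.
Proof.
rewrite -[leRHS]mul1r; apply: mean_area_bound => U.
exact: mean_area_orthonormal_le1.
Qed.

Lemma mean_area_nonincreasing Y :
  {homo mean_area^~ Y : m n / (m <= n)%N >-> n <= m}.
Proof.
move=> m n /subnKC<-; rewrite mean_areaD.
by apply: ler_sum => s _; exact: mean_area_le_area.
Qed.

Hypothesis no_dark : ~ exists p : 'M[C]_d,
  [/\ orthogonal_projection p, (2 <= \rank p)%N & dark_projection a p].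

(* The dark projection that the equality case would produce is U^* U. *)
Lemma orthonormal_contracted (U : 'M[C]_(2, d)) :
  U *m U ^t* = 1%:M -> exists n, mean_area n U < 1.
Proof.
move=> U1; apply: contrapT => no_n; apply: no_dark.
(* If no length contracts, AM-GM is an equality at every word: one strict term would push the mean
   area at that length below the sum of the half traces, which is 1. *)
have eq_area s : area (U *m word_op s) = gram_trace (U *m word_op s) / 2.
  apply/eqP; rewrite eq_le area_le_trace leNgt; apply/negP => lt_s.
  apply: no_n; exists (size s).
  rewrite -[ltRHS](@divff _ 2)// -[X in X / _](gram_trace_orthonormal U1).
  rewrite -(sum_gram_trace (size s)) mulr_suml /mean_area.
  have s_words : s \in words _ (size s) by rewrite mem_words.
  rewrite (big_rem s s_words)/= [ltRHS](big_rem s s_words)/=.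
  by rewrite ltr_leD// ler_sum// => t _; exact: area_le_trace.
exists (U ^t* *m U); split.
- split; last by rewrite -mulmxA (mulmxA U) U1 mul1mx.
  by apply/is_hermitianmxP; rewrite expr0 scale1r trmxC_mul trmxCK.
- have rkU : \rank (U *m (U ^t* *m U) *m U ^t*) = 2%N.
    by rewrite mulmxA U1 mul1mx U1 mxrank1.
  by rewrite -{1}rkU (leq_trans (mxrankM_maxl _ _))// mxrankM_maxr.
- move=> s _; exists (area (U *m word_op s)); first exact: area_ge0.
  rewrite -word_opC -/(word_op s).
  (* In the middle stands the Gram matrix of the image pair, a scalar matrix by the equality case of
     AM-GM. *)
  transitivity (U ^t* *m ((U *m word_op s) *m (U *m word_op s) ^t*) *m U).
    by rewrite trmxC_mul !mulmxA.
  by rewrite (area_eq_trace (eq_area s)) mul_mx_scalar -scalemxAl.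
Qed.

End Contraction.

(** * Continuity of complex-valued and matrix-valued functions *)

Section ComplexContinuity.
Variables (T : topologicalType) (R : realType).
Local Notation C := R[i].

(** Stated on real and imaginary parts, so that only the topology of [R] is involved. *)
Definition ccontinuous (f : T -> C) :=
  continuous (fun x => complex.Re (f x)) /\
  continuous (fun x => complex.Im (f x)).

Lemma ccontinuous_cst c : ccontinuous (fun=> c).
Proof. by split=> x; exact: cvg_cst. Qed.

Lemma ccontinuousD f g :
  ccontinuous f -> ccontinuous g -> ccontinuous (fun x => f x + g x).
Proof.
move=> [fr fi] [gr gi]; split.
- under eq_fun do rewrite raddfD; move=> x; apply: cvgD; [exact: fr|exact: gr].
- under eq_fun do rewrite raddfD; move=> x; apply: cvgD; [exact: fi|exact: gi].
Qed.

Lemma ccontinuousN f : ccontinuous f -> ccontinuous (fun x => - f x).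
Proof.
move=> [fr fi]; split.
- under eq_fun do rewrite raddfN; move=> x; apply: cvgN; exact: fr.
- under eq_fun do rewrite raddfN; move=> x; apply: cvgN; exact: fi.
Qed.

Lemma ccontinuousM f g :
  ccontinuous f -> ccontinuous g -> ccontinuous (fun x => f x * g x).
Proof.
move=> [fr fi] [gr gi].
have ReM (z w : C) : complex.Re (z * w) =
    complex.Re z * complex.Re w - complex.Im z * complex.Im w.
  by case: z w => ? ? [].
have ImM (z w : C) : complex.Im (z * w) =
    complex.Re z * complex.Im w + complex.Im z * complex.Re w.
  by case: z w => ? ? [].
split.
- under eq_fun do rewrite ReM; move=> x.
  by apply: cvgB; apply: cvgM; [exact: fr|exact: gr|exact: fi|exact: gi].
- under eq_fun do rewrite ImM; move=> x.
  by apply: cvgD; apply: cvgM; [exact: fr|exact: gi|exact: fi|exact: gr].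
Qed.

Lemma ccontinuous_conj f : ccontinuous f -> ccontinuous (fun x => (f x)^*%C).
Proof.
move=> [fr fi].
have ReJ (z : C) : complex.Re z^*%C = complex.Re z by case: z.
have ImJ (z : C) : complex.Im z^*%C = - complex.Im z by case: z.
split.
- by under eq_fun do rewrite ReJ.
- under eq_fun do rewrite ImJ; move=> x; apply: cvgN; exact: fi.
Qed.

Lemma ccontinuous_sum (I : Type) (r : seq I) (F : I -> T -> C) :
  (forall i, ccontinuous (F i)) -> ccontinuous (fun x => \sum_(i <- r) F i x).
Proof.
move=> Fc; elim: r => [|i r IHr].
  by under eq_fun do rewrite big_nil; exact: ccontinuous_cst.
by under eq_fun do rewrite big_cons; exact: ccontinuousD.
Qed.

Definition mxcontinuous m n (F : T -> 'M[C]_(m, n)) :=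
  forall i j, ccontinuous (fun x => F x i j).

Lemma mxcontinuous_cst m n (A : 'M[C]_(m, n)) : mxcontinuous (fun=> A).
Proof. by move=> i j; exact: ccontinuous_cst. Qed.

Lemma mxcontinuousM m n p (F : T -> 'M[C]_(m, n)) (G : T -> 'M[C]_(n, p)) :
  mxcontinuous F -> mxcontinuous G -> mxcontinuous (fun x => F x *m G x).
Proof.
move=> Fc Gc i j; under eq_fun do rewrite mxE.
by apply: ccontinuous_sum => l; apply: ccontinuousM.
Qed.

Lemma mxcontinuous_trmxC m n (F : T -> 'M[C]_(m, n)) :
  mxcontinuous F -> mxcontinuous (fun x => (F x) ^t*).
Proof.
by move=> Fc i j; under eq_fun do rewrite !mxE; exact: ccontinuous_conj.
Qed.

Lemma continuous_area n (F : T -> 'M[C]_(2, n)) :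
  mxcontinuous F -> continuous (fun x => area (F x)).
Proof.
move=> Fc; have FF := mxcontinuousM Fc (mxcontinuous_trmxC Fc).
have [detc _] : ccontinuous (fun x => \det (F x *m (F x) ^t*)).
  under eq_fun do rewrite det_mx22.
  by apply: ccontinuousD; [|apply: ccontinuousN]; apply: ccontinuousM.
move=> x; apply: (continuous_comp (detc x)); exact: sqrt_continuous.
Qed.

End ComplexContinuity.

(** * Compactness of orthonormal pairs and geometric decay of mean areas *)

Section OrthonormalPairs.
Variables (R : realType) (d : nat).
Local Notation C := R[i].
Local Notation coords := 'rV[R]_(2 * d + 2 * d).

(** Real coordinates, so that compactness can be taken from a product of real segments. *)
Definition mx_of_coords (x : coords) : 'M[C]_(2, d) :=
  \matrix_(i, j) (x 0 (lshift _ (mxvec_index i j)) +i*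
                  x 0 (rshift _ (mxvec_index i j))).

Definition coords_of_mx (U : 'M[C]_(2, d)) : coords :=
  row_mx (mxvec (map_mx (@complex.Re R) U)) (mxvec (map_mx (@complex.Im R) U)).

Lemma coords_of_mxK : cancel coords_of_mx mx_of_coords.
Proof.
move=> U; apply/matrixP => i j.
by rewrite mxE row_mxEl row_mxEr !mxvecE !mxE; case: (U i j).
Qed.

Lemma mx_of_coords_continuous : mxcontinuous mx_of_coords.
Proof.
move=> i j; under eq_fun do rewrite mxE.
by split=> x; exact: coord_continuous.
Qed.

Lemma orthonormal_entry_le1 (U : 'M[C]_(2, d)) i j : U *m U ^t* = 1%:M ->
  `|complex.Re (U i j)| <= 1 /\ `|complex.Im (U i j)| <= 1.
Proof.
move=> U1; have : `|U i j| ^+ 2 <= 1.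
  have <- : (U *m U ^t*) i i = 1 by rewrite U1 mxE eqxx.
  rewrite mxE (bigD1 j)//= !mxE -normCK lerDl.
  by apply: sumr_ge0 => l _; rewrite !mxE mul_conjC_ge0.
rewrite -add_Re2_Im2 lecR; set u := complex.Re _; set v := complex.Im _ => uv.
have := sqr_ge0 u; have := sqr_ge0 v => v0 u0.
by split; rewrite -(@ler_pXn2r _ 2) ?nnegrE// expr1n real_normK ?num_real//;
  lra.
Qed.

Lemma orthonormal_coords_box U : U *m U ^t* = 1%:M ->
  [set v : coords | forall i, `[-1, 1]%classic (v ord0 i)] (coords_of_mx U).
Proof.
move=> U1 i /=; case: (split_ordP i) => l ->; rewrite ?row_mxEl ?row_mxEr.
all: case/mxvec_indexP: l => u v; rewrite mxvecE mxE in_itv/= -ler_norml.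
all: by have [] := orthonormal_entry_le1 u v U1.
Qed.

Variables (k : nat) (a : 'I_k.+1 -> 'M[C]_d).
Hypothesis a_perfect : perfect_measurement a.
Hypothesis no_dark : ~ exists p : 'M[C]_d,
  [/\ orthogonal_projection p, (2 <= \rank p)%N & dark_projection a p].

Lemma mean_area_continuous n :
  continuous (fun x : coords => mean_area a n (mx_of_coords x)).
Proof.
apply: continuous_big => [|s _]; first exact: add_continuous.
apply: continuous_area.
apply: mxcontinuousM; last exact: mxcontinuous_cst.
exact: mx_of_coords_continuous.
Qed.

(* The sets [mean_area n < 1 - 1 / (n + 1)] increase with n and cover the
   orthonormal pairs. *)
Lemma uniform_contraction : exists2 n, (0 < n)%N & forall U : 'M[C]_(2, d),
  U *m U ^t* = 1%:M -> mean_area a n U <= 1 - n.+1%:R^-1.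
Proof.
(* Orthonormality is a premise inside [P], so the compactness argument can run over the whole box
   [K]. *)
pose P n (x : coords) := mx_of_coords x *m (mx_of_coords x) ^t* = 1%:M ->
  mean_area a n (mx_of_coords x) <= 1 - n.+1%:R^-1.
pose K : set coords := [set v | forall i, `[-1, 1]%classic (v ord0 i)].
have K_compact : compact K.
  exact: (@rV_compact R _ (fun=> `[-1, 1]%classic)
                      (fun=> @segment_compact R _ _)).
suff : \forall n \near \oo, K `<=` P n.
  move=> KP; have [n n0 nP] : exists2 n, (0 < n)%N & K `<=` P n.
    by have [N _ NP] := KP; exists N.+1 => //; exact: (NP N.+1 (leqnSn N)).
  exists n => // U U1; have /nP := orthonormal_coords_box U1.
  by rewrite /P coords_of_mxK; exact.
move/compact_near_coveringP : K_compact; apply => x _.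
have [x1|/eqP x1] := eqVneq (mx_of_coords x *m (mx_of_coords x) ^t*) 1%:M.
  have [n n1] := orthonormal_contracted a_perfect no_dark x1.
  set m := mean_area a n (mx_of_coords x) in n1.
  (* The midpoint between [m] and 1 leaves room on both sides: continuity keeps nearby values at
     length [n] below it, and large [i] put [1 - 1 / (i + 1)] above it. *)
  have c1 : m < (m + 1) / 2 by lra.
  have e0 : 0 < (1 - m) / 2 by lra.
  exists ([set y | mean_area a n (mx_of_coords y) < (m + 1) / 2],
          [set i | (n <= i)%N /\ i.+1%:R^-1 < (1 - m) / 2]).
    split => /=; first exact: (cvgr_lt _ (@mean_area_continuous n x) _ c1).
    near=> i; split; first by near: i; exact: nbhs_infty_ge.
    by near: i; exact: (near_infty_natSinv_lt (PosNum e0)).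
  move=> [y i] [/= yc [ni ic]] _ /=.
  apply: le_trans (mean_area_nonincreasing a_perfect (mx_of_coords y) ni) _.
  apply: le_trans (ltW yc) _; rewrite lerBrDl -lerBrDr.
  by apply: le_trans (ltW ic) _; lra.
(* Failure of orthonormality at [x] is an open condition, witnessed by one entry of the Gram matrix,
   so [P] holds vacuously nearby. *)
have [i [j xij]] : exists i j, (mx_of_coords x *m (mx_of_coords x) ^t*) i j !=
    1%:M i j.
  apply: contrapT => nij; apply: x1; apply/matrixP => i j; apply/eqP.
  by apply: contrapT => /negP xij; apply: nij; exists i, j.
pose D y := (mx_of_coords y *m (mx_of_coords y) ^t*) i j - 1%:M i j.
have [ReD ImD] : ccontinuous D.
  apply: ccontinuousD; last exact: ccontinuous_cst.
  by apply: mxcontinuousM; [|apply: mxcontinuous_trmxC];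
    exact: mx_of_coords_continuous.
have D_neq0 : complex.Re (D x) != 0 \/ complex.Im (D x) != 0.
  apply/orP; rewrite -negb_and; move: xij; rewrite -subr_eq0 -/(D x).
  by rewrite eq_complex.
exists ([set y | D y != 0], setT).
  split => /=; last exact: filterT.
  case: D_neq0 => D0.
  - apply: filterS (cvgr_neq0 _ (ReD x) D0) => y.
    by apply: contraNN => /eqP->.
  - apply: filterS (cvgr_neq0 _ (ImD x) D0) => y.
    by apply: contraNN => /eqP->.
by move=> [y n] [/= /negP Dy _] y1; exfalso; apply: Dy; rewrite /D y1 subrr.
Unshelve. all: by end_near.
Qed.

(* The rate is a square because half of it is spent on the Markov inequality
   and the other half makes the probabilities summable. *)
Lemma mean_area_geometric : exists (c r : R), [/\ 0 <= c, 0 < r, r < 1 &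
  forall n Y, mean_area a n Y <= c * (r ^+ 2) ^+ n * area Y].
Proof.
have [n n_gt0 nU] := uniform_contraction.
have nY := mean_area_bound nU.
have i1 : 0 < n.+1%:R^-1 :> R by rewrite invr_gt0.
have i2 : n.+1%:R^-1 < 1 :> R by rewrite invf_lt1// ltr1n.
move: nY i1 i2; move: n.+1%:R^-1 => z nY z0 z1; set q := 1 - z in nY.
have n1R : 1 <= n%:R :> R by rewrite ler1n.
have q0 : 0 < q by rewrite /q subr_gt0.
(* Chosen so that Bernoulli's inequality gives [(1 - y)^(2 n) >= 1 - 2 n y = 1 - z = q]. *)
pose y : R := z / (2 * n%:R).
have y0 : 0 < y by rewrite divr_gt0// mulr_gt0//; lra.
have y1 : y < 1 by rewrite /y ltr_pdivrMr; lra.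
have bernoulli m : 1 - m%:R * y <= (1 - y) ^+ m.
  elim: m => [|m IHm]; first by rewrite mul0r subr0 expr0.
  rewrite exprS -natr1; have m0 : 0 <= m%:R :> R by [].
  apply: le_trans (ler_wpM2l _ IHm); last lra.
  by have := mulr_ge0 m0 (sqr_ge0 y); rewrite expr2; lra.
pose r := 1 - y; have r0 : 0 < r by rewrite /r; lra.
have r1 : r < 1 by rewrite /r; lra.
have qr : q <= (r ^+ 2) ^+ n.
  rewrite -exprM; apply: le_trans (bernoulli _).
  by rewrite natrM /y mulrC divfK//; lra.
have rm m : 0 <= (r ^+ 2) ^+ m by rewrite !exprn_ge0// ltW.
(* The constant [q^-1] absorbs an incomplete block: for [m < n], [(r^2)^m >= (r^2)^n >= q]. *)
exists q^-1, r; split => //; first by rewrite invr_ge0 ltW.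
elim/ltn_ind => m IHm Y; have [mn|nm] := ltnP m n.
  apply: le_trans (mean_area_le_area a_perfect _ _) _.
  rewrite -[leLHS]mul1r ler_wpM2r ?area_ge0// mulrC ler_pdivlMr// mul1r.
  apply: le_trans qr _; have [r0' r1'] := (ltW r0, ltW r1).
  by apply: ler_wiXn2l; rewrite ?exprn_ge0 ?exprn_ile1// ltnW.
(* The last [n] letters contribute a factor [q], and the induction hypothesis handles the first
   [m - n]. *)
rewrite -{1}(subnK nm) mean_areaD.
apply: (@le_trans _ _ (q * mean_area a (m - n) Y)).
  by rewrite mulr_sumr; apply: ler_sum => s _; exact: nY.
apply: le_trans (ler_wpM2l (ltW q0) (IHm _ _ _)) _.
  by rewrite ltn_subrL n_gt0 (leq_trans n_gt0).
rewrite -{2}(subnK nm) exprD !mulrA divff ?gt_eqF// mul1r.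
rewrite ler_wpM2r ?area_ge0// mulrAC -[leLHS]mul1r ler_wpM2r//.
by rewrite mulrC ler_pdivlMr// mul1r.
Qed.
End OrthonormalPairs.

(** * Spectral theory of positive semidefinite matrices *)

Section PositiveSemidefinite.
Variables (R : realType) (d : nat).
Local Notation C := R[i].

Lemma psdmx_spectral (A : 'M[C]_d) : psdmx A ->
  exists (P : 'M[C]_d) (l : 'rV[C]_d), [/\ P *m P ^t* = 1%:M,
    A = P ^t* *m diag_mx l *m P & forall j, 0 <= l 0 j].
Proof.
move=> [A_herm A_ge0].
have A_spec := orthomx_spectralP (hermitian_normalmx A_herm).
have P_unitary := spectral_unitarymx A.
set P := spectralmx A in A_spec P_unitary; set l := spectral_diag A in A_spec.
rewrite invmx_unitary// in A_spec; have P1 := unitarymxP P_unitary.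
exists P, l; split => // j.
(* The columns of [P^*] are eigenvectors, at which the quadratic form takes the eigenvalues as
   values. *)
suff <- : ((col j (P ^t*)) ^t* *m A *m col j (P ^t*)) 0 0 = l 0 j.
  exact: A_ge0.
have -> : (col j (P ^t*)) ^t* = row j P.
  by apply/matrixP => i i'; rewrite !mxE conjCK.
rewrite A_spec colE rowE.
transitivity (((delta_mx 0 j : 'rV_d) *m
    (P *m P ^t* *m diag_mx l *m (P *m P ^t*)) *m delta_mx j 0) 0 (0 : 'I_1)).
  by rewrite !mulmxA.
by rewrite P1 mul1mx mulmx1 -rowE -colE !mxE eqxx mulr1n.
Qed.

(** [B] is the square root of the diagonal part times [P]. The state after a word thereby becomes a
    Gram matrix, see [measurement_word_gram]. *)
Lemma psdmx_factor (A : 'M[C]_d) :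
  psdmx A -> exists B : 'M[C]_d, A = B ^t* *m B.
Proof.
move=> /psdmx_spectral[P [l [_ -> l0]]].
exists (diag_mx (\row_j sqrtC (l 0 j)) *m P).
rewrite trmxC_mul -!mulmxA; congr (_ *m _).
rewrite mulmxA; congr (_ *m _); rewrite tr_diag_mx map_diag_mx mulmx_diag.
congr diag_mx; apply/rowP => j; rewrite !mxE.
rewrite -[LHS]sqrtCK expr2; congr (_ * _).
by apply/esym; apply: geC0_conj; rewrite sqrtC_ge0.
Qed.

Lemma psdmx_gram m (B : 'M[C]_(m, d)) : psdmx (B ^t* *m B).
Proof.
split; first by apply/is_hermitianmxP; rewrite expr0 scale1r trmxC_mul trmxCK.
move=> v; have -> : v ^t* *m (B ^t* *m B) *m v = (B *m v) ^t* *m (B *m v).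
  by rewrite trmxC_mul !mulmxA.
by rewrite mxE sumr_ge0// => i _; rewrite !mxE mulrC mul_conjC_ge0.
Qed.

Lemma psdmxZ (c : C) (A : 'M[C]_d) : 0 <= c -> psdmx A -> psdmx (c *: A).
Proof.
move=> c0 [/is_hermitianmxP A_herm A_ge0]; split.
  apply/is_hermitianmxP; rewrite expr0 scale1r linearZ/= map_mxZ {1}A_herm.
  rewrite expr0 scale1r.
  by congr (_ *: _); apply/esym; exact: geC0_conj.
by move=> v; rewrite -scalemxAr -scalemxAl mxE mulr_ge0.
Qed.

(* On the spectrum, [l - l^(n+1) <= n (l - l^2)] for [0 <= l <= 1]. *)
Lemma density_trace_power (A : 'M[C]_d) n : density_matrix A -> (0 < n)%N ->
  0 <= 1 - \tr (A ^+ n) <= n%:R * (1 - \tr (A ^+ 2)).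
Proof.
move=> [/psdmx_spectral[P [l [P1 AE l0]]] trA].
have A_pow m : A ^+ m = P ^t* *m diag_mx (\row_j (l 0 j ^+ m)) *m P.
  elim: m => [|m IHm].
    have -> : \row_j (l 0 j ^+ 0) = const_mx 1 by apply/rowP => j; rewrite !mxE.
    by rewrite diag_const_mx mulmx1 (mulmx1C P1) expr0.
  rewrite exprS IHm {1}AE -mulmxE.
  transitivity (P ^t* *m (diag_mx l *m (P *m P ^t*) *m
      diag_mx (\row_j (l 0 j ^+ m))) *m P).
    by rewrite !mulmxA.
  rewrite P1 mulmx1 mulmx_diag; congr (_ *m diag_mx _ *m _).
  by apply/rowP => j; rewrite !mxE exprS.
have tr_pow m : \tr (A ^+ m) = \sum_j l 0 j ^+ m.
  rewrite A_pow mxtrace_mulC mulmxA P1 mul1mx mxtrace_diag.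
  by apply: eq_bigr => j _; rewrite mxE.
have sum_l : \sum_j l 0 j = 1.
  by rewrite -trA -[A]expr1 tr_pow; apply: eq_bigr => j _; rewrite expr1.
have l1 j : l 0 j <= 1.
  by rewrite -sum_l (bigD1 j)//= lerDl; apply: sumr_ge0.
have defect m : 1 - \tr (A ^+ m) = \sum_j (l 0 j - l 0 j ^+ m).
  by rewrite sumrB sum_l tr_pow.
case: n => // n _; rewrite !defect mulr_sumr.
have pow_le1 j m : l 0 j ^+ m.+1 <= l 0 j.
  by rewrite exprS ler_piMr// exprn_ile1.
apply/andP; split; first by apply: sumr_ge0 => j _; rewrite subr_ge0.
apply: ler_sum => j _; elim: n => [|n IHn].
  by rewrite expr1 subrr mul1r subr_ge0.
(* Telescoping: the new increment is [l^n (l - l^2)], at most [l - l^2]. *)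
rewrite -natr1 mulrDl mul1r -(subrKA (l 0 j ^+ n.+1)) lerD//.
have -> : l 0 j ^+ n.+1 - l 0 j ^+ n.+2 = l 0 j ^+ n * (l 0 j - l 0 j ^+ 2).
  by rewrite !exprS; ring.
by rewrite ler_piMl ?exprn_ile1// subr_ge0.
Qed.

End PositiveSemidefinite.

(** * Purity of a normalized Gram matrix in terms of areas *)

Section Purity.
Variables (R : realType).
Local Notation C := R[i].

(** The indices may coincide; the area of such a pair is 0. *)
Definition row_pair m n (i j : 'I_m) (W : 'M[C]_(m, n)) : 'M[C]_(2, n) :=
  rowsub (fun l : 'I_2 => if l == 0 then i else j) W.

Lemma row_pairM m n p i j (W : 'M[C]_(m, n)) (A : 'M[C]_(n, p)) :
  row_pair i j (W *m A) = row_pair i j W *m A.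
Proof. by rewrite /row_pair mul_rowsub_mx. Qed.

(** The areas enter linearly, as in [mean_area], whereas [purity_defect] involves their squares;
    [sum_sqr_le_sqr_sum] relates the two. *)
Definition total_area m n (W : 'M[C]_(m, n)) : R :=
  \sum_i \sum_j area (row_pair i j W).

Lemma total_area_ge0 m n (W : 'M[C]_(m, n)) : 0 <= total_area W.
Proof. by do 2!apply: sumr_ge0 => ? _; exact: area_ge0. Qed.

Lemma sum_sqr_le_sqr_sum (I : Type) (r : seq I) (F : I -> R) :
  (forall i, 0 <= F i) -> \sum_(i <- r) F i ^+ 2 <= (\sum_(i <- r) F i) ^+ 2.
Proof.
move=> F0; elim: r => [|i r IHr]; first by rewrite !big_nil expr0n.
rewrite !big_cons; have s0 : 0 <= \sum_(j <- r) F j by exact: sumr_ge0.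
by rewrite sqrrD addrAC -addrA lerD2l ler_wpDr ?mulrn_wge0 ?mulr_ge0.
Qed.

Lemma gram_tr m n (W : 'M[C]_(m, n)) : \tr (W ^t* *m W) = (gram_trace W)%:C.
Proof. by rewrite mxtrace_mulC gram_traceE. Qed.

(* (tr H)^2 - tr (H^2) is the sum of all the 2 x 2 principal minors, here of
   the Gram matrix H = W W^*. *)
Lemma purity_defect m n (W : 'M[C]_(m, n)) :
  (gram_trace W)%:C ^+ 2 - \tr (W ^t* *m W *m (W ^t* *m W)) =
  (\sum_i \sum_j area (row_pair i j W) ^+ 2)%:C.
Proof.
rewrite -gram_traceE; set H := W *m W ^t*.
have -> : \tr (W ^t* *m W *m (W ^t* *m W)) = \tr (H *m H).
  by rewrite -mulmxA mxtrace_mulC /H !mulmxA.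
rewrite expr2 {1 2}/mxtrace mulr_suml /mxtrace rmorph_sum -sumrB.
apply: eq_bigr => i _; rewrite mulr_sumr [in X in _ - X]mxE rmorph_sum -sumrB.
apply: eq_bigr => j _; rewrite /= -det_gramE det_mx22.
have pairE l l' : (row_pair i j W *m (row_pair i j W) ^t*) l l' =
    H (if l == 0 then i else j) (if l' == 0 then i else j).
  by rewrite !mxE; apply: eq_bigr => u _; rewrite !mxE.
by rewrite !pairE/=.
Qed.

(** After normalization the purity defect is at most [(total_area W / t)^2], with [t] the trace;
    [density_trace_power] passes to the power [l] at the cost of a factor [l]. *)
Lemma normalized_power_near1 m n (W : 'M[C]_(m, n)) e l :
  0 <= e -> total_area W < e * gram_trace W -> (0 < l)%N ->
  `|1 - \tr (((\tr (W ^t* *m W))^-1 *: (W ^t* *m W)) ^+ l)|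
    <= (l%:R * e ^+ 2)%:C.
Proof.
move=> e0 We l0; set t := gram_trace W in We.
(* The strict inequality excludes a zero trace, hence the default value of the inverse. *)
have t0 : 0 < t.
  rewrite lt_neqAle gram_trace_ge0 andbT; apply: contraTneq We => <-.
  by rewrite mulr0 -leNgt total_area_ge0.
rewrite gram_tr -/t; set A := _ *: _.
have tC : t%:C != 0 by rewrite gt_eqF// ltcR.
have A_density : density_matrix A.
  split; last by rewrite mxtraceZ gram_tr mulVf.
  by apply: psdmxZ (psdmx_gram W); rewrite invr_ge0 lecR ltW.
have /andP[d0 dl] := density_trace_power A_density l0.
rewrite ger0_norm//; apply: le_trans dl _.
rewrite rmorphM/= rmorph_nat; apply: ler_wpM2l; first exact: ler0n.
have -> : 1 - \tr (A ^+ 2) =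
    ((\sum_i \sum_j area (row_pair i j W) ^+ 2) / t ^+ 2)%:C.
  rewrite rmorphM/= -purity_defect -/t rmorphV ?unitfE ?expf_neq0 ?gt_eqF//=.
  rewrite rmorphXn/= mulrBl divff ?expf_neq0//; congr (_ - _).
  rewrite expr2 -mulmxE /A -scalemxAl -scalemxAr scalerA mxtraceZ.
  by rewrite -expr2 exprVn mulrC.
rewrite lecR ler_pdivrMr ?exprn_gt0// -exprMn.
apply: (@le_trans _ _ (total_area W ^+ 2)).
  apply: le_trans (sum_sqr_le_sqr_sum _ _) => [|i]; last first.
    by apply: sumr_ge0 => j _; exact: area_ge0.
  by apply: ler_sum => i _; apply: sum_sqr_le_sqr_sum => j; exact: area_ge0.
by rewrite ler_pXn2r ?nnegrE ?total_area_ge0 ?mulr_ge0 ?(ltW t0)// ltW.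
Qed.

End Purity.

(** * Probabilities of events determined by finitely many outcomes *)

Section Trajectory.
Variables (R : realType) (d k : nat) (a : 'I_k.+1 -> 'M[R[i]]_d).
Local Notation C := R[i].

Lemma measurement_wordE s (theta : 'M[C]_d) :
  measurement_word a s theta = (word_op a s) ^t* *m theta *m word_op a s.
Proof.
elim: s theta => [|i s IHs] theta.
  by rewrite /word_op big_nil trmx1 map_mx1 mul1mx mulmx1.
rewrite [LHS]IHs word_op_cons trmxC_mul trmxCK /measurement_map.
by rewrite !mulmxA.
Qed.

Variables (B : 'M[C]_d) (P : probability (outcome_space k) R).
Hypothesis P_law : outcome_law a (B ^t* *m B) P.

Lemma measurement_word_gram s :
  measurement_word a s (B ^t* *m B) =
  (B *m word_op a s) ^t* *m (B *m word_op a s).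
Proof. by rewrite measurement_wordE trmxC_mul !mulmxA. Qed.

Lemma cylinder_measurable s : measurable (cylinder s : set (outcome_space k)).
Proof. by apply: sub_sigma_algebra; exists s. Qed.

Lemma cylinder_law s : P (cylinder s) = (gram_trace (B *m word_op a s))%:E.
Proof. by rewrite P_law measurement_word_gram gram_tr. Qed.

Definition prefix_event n (Q : pred (seq 'I_k.+1)) : set (outcome_space k) :=
  [set w | Q (mkseq w n)].

Lemma prefix_eventE n Q :
  prefix_event n Q = \big[setU/set0]_(s <- words _ n | Q s) cylinder s.
Proof.
rewrite -bigcup_seq_cond; apply/seteqP; split => w /=.
  move=> Qw; exists (mkseq w n); last by rewrite /cylinder/= size_mkseq.
  by rewrite /= Qw andbT mem_words size_mkseq.
case=> s /= /andP[]; rewrite mem_words => /eqP <- Qs.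
by rewrite /cylinder /prefix_event/= => ->.
Qed.

Lemma prefix_event_measurable n Q : measurable (prefix_event n Q).
Proof.
rewrite prefix_eventE; apply: bigsetU_measurable => s _.
exact: cylinder_measurable.
Qed.

(** A union bound over the cylinders of the words in [Q]; the words outside only add [F s >= 0].
    This is the form in which Markov's inequality is applied. *)
Lemma prefix_event_le n (Q : pred (seq 'I_k.+1)) (F : seq 'I_k.+1 -> R) :
  (forall s, 0 <= F s) ->
  (forall s, size s = n -> Q s -> gram_trace (B *m word_op a s) <= F s) ->
  (P (prefix_event n Q) <= (\sum_(s <- words _ n) F s)%:E)%E.
Proof.
move=> F0 QF; rewrite prefix_eventE.
have {QF} : forall s, s \in words _ n -> Q s ->
    gram_trace (B *m word_op a s) <= F s.
  by move=> s; rewrite mem_words => /eqP; exact: QF.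
elim: (words _ n) => [|s r IHr] QF; first by rewrite !big_nil measure0.
have {}IHr := IHr (fun t tr => QF t (@mem_behead _ (s :: r) t tr)).
rewrite !big_cons EFinD; case: ifPn => [Qs|_]; last first.
  by rewrite -[leLHS]add0e leeD// lee_fin.
apply: (@le_trans _ _ (P (cylinder s) +
    P (\big[setU/set0]_(t <- r | Q t) cylinder t))%E).
  apply: measureU2; first exact: cylinder_measurable.
  by apply: bigsetU_measurable => t _; exact: cylinder_measurable.
by rewrite leeD// cylinder_law lee_fin QF ?mem_head.
Qed.

End Trajectory.

(** * Borel-Cantelli for geometrically decaying probabilities *)

Lemma summable_events_ae d (T : measurableType d) (R : realType)
    (P : {measure set T -> \bar R}) (E : nat -> set T) (c r : R) :
  0 <= c -> 0 < r -> r < 1 -> (forall n, measurable (E n)) ->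
  (forall n, (P (E n) <= (c * r ^+ n)%:E)%E) ->
  {ae P, forall w, \forall n \near \oo, ~ E n w}.
Proof.
move=> c0 r0 r1 E_measurable P_le.
have P0 : P (lim_sup_set E) = 0%E.
  apply: lim_sup_set_cvg0 => //.
  apply: (@le_lt_trans _ _ (c * (1 - r)^-1)%:E); last exact: ltry.
  apply: lime_le; first by apply: is_cvg_nneseries => n _ _; exact: measure_ge0.
  near=> n; apply: (@le_trans _ _ (\sum_(0 <= i < n) (c * r ^+ i)%:E)%E).
    by apply: lee_sum => i _; exact: P_le.
  rewrite sumEFin lee_fin -[leLHS]/(series (geometric c r) n).
  by apply: geometric_le_lim => //; rewrite gtr0_norm.
have lim_sup_measurable : measurable (lim_sup_set E).
  by apply: bigcapT_measurable => n; apply: bigcup_measurable => m _.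
apply: negligibleS ((negligibleP _ lim_sup_measurable).2 P0) => w /= nE n _.
apply: contrapT => nEw; apply: nE; exists n => // m /= nm Em.
by apply: nEw; exists m.
Unshelve. all: by end_near.
Qed.

Theorem corollary5 (R : realType) (d k : nat) (a : 'I_k.+1 -> 'M[R[i]%C]_d)
    (theta0 : 'M[R[i]%C]_d) (P : probability (outcome_space k) R) :
  (0 < d)%N ->
  perfect_measurement a ->
  density_matrix theta0 ->
  outcome_law a theta0 P ->
  purifies_ae a theta0 P \/
  exists p : 'M[R[i]%C]_d,
    [/\ orthogonal_projection p, (2 <= \rank p)%N & dark_projection a p].
Proof.
move=> _ a_perfect [theta0_psd _] P_law.
have [B theta0E] := psdmx_factor theta0_psd.
have [dark|no_dark] := pselect (exists p : 'M[R[i]%C]_d,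
  [/\ orthogonal_projection p, (2 <= \rank p)%N & dark_projection a p]).
  by right.
left; rewrite theta0E in P_law *.
have [c [r [c0 r0 r1 area_decay]]] := mean_area_geometric a_perfect no_dark.
(* Words with a possibly large purity defect. The inequality is weak, so words of zero trace are bad
   too and good words satisfy the strict bound of [normalized_power_near1]. *)
pose bad n s :=
  r ^+ n * gram_trace (B *m word_op a s) <= total_area (B *m word_op a s).
pose K := c * total_area B.
have K0 : 0 <= K by rewrite mulr_ge0 ?total_area_ge0.
have rn n : 0 < r ^+ n by rewrite exprn_gt0.
have P_bad n : (P (prefix_event n (bad n)) <= (K * r ^+ n)%:E)%E.
  (* Markov's inequality: a bad word has probability at most [total_area / r^n]. These bounds sum to
     at most [K (r^2)^n / r^n = K r^n]. *)
  have F0 s : 0 <= total_area (B *m word_op a s) / r ^+ n.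
    by rewrite divr_ge0 ?total_area_ge0 ?ltW.
  apply: (le_trans (prefix_event_le P_law F0 _)) => [s _ bad_s|].
    by rewrite ler_pdivlMr// mulrC.
  rewrite lee_fin -mulr_suml ler_pdivrMr// -mulrA -expr2 -exprM mulnC exprM.
  have -> : \sum_(s <- words _ n) total_area (B *m word_op a s) =
      \sum_i \sum_j mean_area a n (row_pair i j B).
    rewrite exchange_big/=; apply: eq_bigr => i _.
    rewrite exchange_big/=; apply: eq_bigr => j _.
    by apply: eq_bigr => s _; rewrite row_pairM.
  rewrite /K mulrAC mulr_sumr; apply: ler_sum => i _.
  by rewrite mulr_sumr; apply: ler_sum => j _; exact: area_decay.
have := summable_events_ae K0 r0 r1
  (fun n => prefix_event_measurable n (bad n)) P_bad.
apply: filterS => w w_good m m_gt0.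
(* The radius [eps] is a complex number; its positivity makes it real. *)
apply/cvgrPdist_le => eps; rewrite ltcE/= => /andP[/eqP eps_im eps_gt0].
have r2_cvg : (m%:R * (r ^+ n) ^+ 2) @[n --> \oo] --> (0 : R).
  have r_cvg : r ^+ n @[n --> \oo] --> (0 : R).
    by apply: cvg_expr; rewrite gtr0_norm.
  rewrite -(mulr0 m%:R) -(mulr0 (0 : R)); apply: cvgM; first exact: cvg_cst.
  by under eq_fun do rewrite expr2; exact: cvgM.
have r2_small := cvgr_le _ r2_cvg _ eps_gt0.
near=> n; rewrite /quantum_trajectory measurement_word_gram.
(* Almost surely the prefixes are good from some [n] on, and then [e = r^n] is admissible. *)
apply: (@le_trans _ _ (m%:R * (r ^+ n) ^+ 2)%:C).
  apply: normalized_power_near1 => //; first exact: ltW.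
  by rewrite ltNge; apply/negP; near: n.
rewrite lecE /= eps_im eqxx /=; near: n; exact: r2_small.
Unshelve. all: by end_near.
Qed.
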